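(* Let $\theta\in\mathbb R\setminus\mathbb Q$ and let $\alpha$ be the irrational rotation by $\theta$ on $C(\mathbb T)$, i.e., identifying $\mathbb T$ with $\mathbb R/\mathbb Z$, $\alpha(f)(x)=f(x-\theta)$. Then $\dim^{\mathrm s}_{\mathrm{Rok}}(\alpha)=1$.
   Context: Rokhlin dimension with single towers: for a unital $C^*$-algebra $A$ and $\alpha\in\mathrm{Aut}(A)$ (identified with the $\mathbb Z$-action it generates), $\dim^{\mathrm s}_{\mathrm{Rok}}(\alpha)$ is the least natural number $d\ge0$ (or $\infty$ if there is none) such that for any finite $F\subset A$, any $p\in\mathbb N$ and any $\varepsilon>0$ there are positive elements $f^{(l)}_{0,0},\ldots,f^{(l)}_{0,p-1},f^{(l)}_{1,0},\ldots,f^{(l)}_{1,p}\in A$, $l\in\{0,\ldots,d\}$, such that for each $l$ one of the towers $(f^{(l)}_{0,j})_j$ or $(f^{(l)}_{1,j})_j$ vanishes, and (1) for any $l$, $\|f^{(l)}_{q,i}f^{(l)}_{r,j}\|<\varepsilon$ whenever $(q,i)\ne(r,j)$; (2) $\|\sum_{l=0}^d\sum_{r=0}^1\sum_{j=0}^{p-1+r}f^{(l)}_{r,j}-1\|<\varepsilon$; (3) $\|\alpha(f^{(l)}_{r,j})-f^{(l)}_{r,j+1}\|<\varepsilon$ for all $r\in\{0,1\}$, $j\in\{0,\ldots,p-2+r\}$ and all $l$; (4) $\|\alpha(f^{(l)}_{0,p-1}+f^{(l)}_{1,p})-(f^{(l)}_{0,0}+f^{(l)}_{1,0})\|<\varepsilon$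 for all $l$; (5) $\|[f^{(l)}_{r,j},a]\|<\varepsilon$ for all $r,j,l$ and $a\in F$. *)

(* Defs.v *)
From HB Require Import structures.
From mathcomp Require Import all_boot all_order all_algebra generic_quotient ring_quotient.
From mathcomp Require Import all_classical all_reals topology normedtype.
From mathcomp Require Import complex lra.
Set Implicit Arguments.
Unset Strict Implicit.
Unset Printing Implicit Defensive.
Import Order.TTheory GRing.Theory Num.Theory.
Import numFieldTopology.Exports numFieldNormedType.Exports.
Local Open Scope classical_set_scope.
Local Open Scope complex_scope.
Local Open Scope ring_scope.

(* Unital C*-algebras over R[i], the complex numbers.  The norm is real-valued
   and part of the structure, since the hierarchy has no join of NormedModule
   and Algebra.  An algType is nontrivial, so the zero algebra is excluded. *)
HB.mixin Record isCStarAlgebra (R : realType) A & GRing.Algebra R[i] A := {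
  cnorm : A -> R;
  cstar : A -> A;
  cnormD_le : forall a b : A, cnorm (a + b) <= cnorm a + cnorm b;
  cnormZ : forall (z : R[i]) (a : A),
    (cnorm (z *: a))%:C = `|z| * (cnorm a)%:C;
  cnorm0_eq0 : forall a : A, cnorm a = 0 -> a = 0;
  cnormM_le : forall a b : A, cnorm (a * b) <= cnorm a * cnorm b;
  cnorm_complete : forall u : nat -> A,
    (forall e, 0 < e -> exists N, forall m n, (N <= m)%N -> (N <= n)%N ->
       cnorm (u m - u n) < e) ->
    exists l, forall e, 0 < e -> exists N, forall n, (N <= n)%N ->
       cnorm (u n - l) < e;
  cstarK : involutive cstar;
  cstarD : {morph cstar : a b / a + b};
  cstarZ : forall (z : R[i]) (a : A), cstar (z *: a) = z^* *: cstar a;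
  cstarM : forall a b : A, cstar (a * b) = cstar b * cstar a;
  cnorm_starM : forall a : A, cnorm (cstar a * a) = cnorm a ^+ 2
}.
#[short(type = "cstarAlgType")]
HB.structure Definition CStarAlgebra (R : realType) :=
  {A of GRing.Algebra R[i] A & isCStarAlgebra R A}.

(* Elements of Aut(A): unital *-automorphisms of A. *)
Record cstar_aut (R : realType) (A : cstarAlgType R) := CStarAut {
  aut_fun :> {lrmorphism A -> A};
  aut_star : forall a : A, aut_fun (cstar a) = cstar (aut_fun a);
  aut_bij : bijective aut_fun
}.

Section positivity.
Variables (R : realType) (A : cstarAlgType R).

Definition invertible_elt (a : A) := exists b, a * b = 1 /\ b * a = 1.
Definition spectrum (a : A) : set R[i] := [set z | ~ invertible_elt (a - z%:A)].
(* In the order of R[i], 0 <= z means that z is real and nonnegative. *)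
Definition positive_elt (a : A) :=
  cstar a = a /\ forall z, spectrum a z -> 0 <= z.
End positivity.

Section rokhlin.
Variables (R : realType) (A : cstarAlgType R) (alpha : cstar_aut A).

(* f l r j is the element f^{(l)}_{r,j}; the tower r has height p + r, and only
   its values at indices j < p + r matter.  Here p > 0 is assumed: condition (4)
   refers to f^{(l)}_{0,p-1}. *)
Definition single_towers (d : nat) (F : set A) (p : nat) (e : R)
    (f : 'I_d.+1 -> 'I_2 -> nat -> A) : Prop :=
  [/\ forall l (r : 'I_2) j, (j < p + r)%N -> positive_elt (f l r j),
      forall l, exists r : 'I_2, forall j, (j < p + r)%N -> f l r j = 0
    & [/\ forall l (q r : 'I_2) i j, (i < p + q)%N -> (j < p + r)%N ->
          (q, i) <> (r, j) -> cnorm (f l q i * f l r j) < e,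
        cnorm (\sum_(l < d.+1) \sum_(r < 2) \sum_(j < p + r) f l r j - 1) < e,
        forall l (r : 'I_2) j, (j.+1 < p + r)%N ->
          cnorm (alpha (f l r j) - f l r j.+1) < e,
        forall l, cnorm (alpha (f l 0 p.-1 + f l 1 p)
                           - (f l 0 0%N + f l 1 0%N)) < e
      & forall l (r : 'I_2) j a, (j < p + r)%N -> F a ->
          cnorm (f l r j * a - a * f l r j) < e]].

Definition has_single_towers (d : nat) : Prop :=
  forall (F : set A) (p : nat) (e : R), finite_set F -> (0 < p)%N -> 0 < e ->
  exists f, @single_towers d F p e f.

(* The least such d; None stands for infinity. *)
Definition dimRok_s : option nat :=
  if pselect (exists d, `[< has_single_towers d >]) is left ex
  then Some (ex_minn ex) else None.
End rokhlin.

(* Nonempty (pointed) compact spaces X, so that C(X) is nontrivial. *)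
HB.mixin Record isCompactSpace X & PointedTopological X := {
  space_compact : compact [set: X]
}.
#[short(type = "compactSpaceType")]
HB.structure Definition CompactSpace :=
  {X of PointedTopological X & isCompactSpace X}.

Section CX.
Variables (R : realType) (X : compactSpaceType).
Local Notation C := (R[i]^o).

(* C(X), with pointwise operations and the supremum norm. *)
Definition cfun : Type := continuousType X C.
HB.instance Definition _ := Choice.on cfun.

Implicit Types f g h : cfun.

Definition mkcfun (f : X -> C) (fc : continuous f) : cfun :=
  Continuous.clone _ _ (mkcts fc) _.

Lemma cfunP f g : f =1 g -> f = g.
Proof. by move/continuousEP. Qed.

Lemma cfun_cts f : continuous (f : X -> C).
Proof. exact: (@cts_fun X C f). Qed.

Let cst_cts (z : C) : continuous (fun _ : X => z).
Proof. exact: cst_continuous. Qed.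
Let opp_cts f : continuous (fun x => - f x : C).
Proof. by move=> x; apply: cvgN; exact: cfun_cts. Qed.
Let add_cts f g : continuous (fun x => f x + g x : C).
Proof. by move=> x; apply: cvgD; exact: cfun_cts. Qed.
Let mul_cts f g : continuous (fun x => f x * g x : C).
Proof. by move=> x; apply: (@cvgZ R[i] C); exact: cfun_cts. Qed.
Let scale_cts (z : R[i]) f : continuous (fun x => z * f x : C).
Proof. by move=> x; apply: (@cvgZl_tmp R[i] C); exact: cfun_cts. Qed.
Let star_cts f : continuous (fun x => (f x)^* : C).
Proof.
move=> x; apply/cvgrPdist_lt => e e0.
have /cvgrPdist_lt/(_ e e0) := @cfun_cts f x.
by apply: filterS => y; rewrite -rmorphB norm_conjC.
Qed.

Definition cfun_zero := mkcfun (@cst_cts 0).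
Definition cfun_one := mkcfun (@cst_cts 1).
Definition cfun_opp f := mkcfun (@opp_cts f).
Definition cfun_add f g := mkcfun (@add_cts f g).
Definition cfun_mul f g := mkcfun (@mul_cts f g).
Definition cfun_scale z f := mkcfun (@scale_cts z f).
Definition cfun_star f := mkcfun (@star_cts f).

Let addA : associative cfun_add.
Proof. by move=> f g h; apply: cfunP => x; exact: addrA. Qed.
Let addC : commutative cfun_add.
Proof. by move=> f g; apply: cfunP => x; exact: addrC. Qed.
Let add0 : left_id cfun_zero cfun_add.
Proof. by move=> f; apply: cfunP => x; exact: add0r. Qed.
Let addN : left_inverse cfun_zero cfun_opp cfun_add.
Proof. by move=> f; apply: cfunP => x; exact: addNr. Qed.
HB.instance Definition _ := GRing.isZmodule.Build cfun addA addC add0 addN.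

Let mulA : associative cfun_mul.
Proof. by move=> f g h; apply: cfunP => x; exact: mulrA. Qed.
Let mulC : commutative cfun_mul.
Proof. by move=> f g; apply: cfunP => x; exact: mulrC. Qed.
Let mul1 : left_id cfun_one cfun_mul.
Proof. by move=> f; apply: cfunP => x; exact: mul1r. Qed.
Let mulDl : left_distributive cfun_mul +%R.
Proof. by move=> f g h; apply: cfunP => x; exact: mulrDl. Qed.
Let one_neq0 : cfun_one != 0.
Proof.
apply/eqP => /(congr1 (fun f : cfun => f point)) /eqP.
by rewrite /= oner_eq0.
Qed.
HB.instance Definition _ :=
  GRing.Zmodule_isComNzRing.Build cfun mulA mulC mul1 mulDl one_neq0.

Let scaleA a b f : cfun_scale a (cfun_scale b f) = cfun_scale (a * b) f.
Proof. by apply: cfunP => x; exact: mulrA. Qed.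
Let scale1 : left_id 1 cfun_scale.
Proof. by move=> f; apply: cfunP => x; exact: mul1r. Qed.
Let scaleDr : right_distributive cfun_scale +%R.
Proof. by move=> a f g; apply: cfunP => x; exact: mulrDr. Qed.
Let scaleDl f : {morph cfun_scale^~ f : a b / a + b}.
Proof. by move=> a b; apply: cfunP => x; exact: mulrDl. Qed.
HB.instance Definition _ :=
  GRing.Zmodule_isLmodule.Build R[i] cfun scaleA scale1 scaleDr scaleDl.

Let scaleAl (a : R[i]) (f g : cfun) : a *: (f * g) = a *: f * g.
Proof. by apply: cfunP => x; exact: mulrA. Qed.
HB.instance Definition _ := GRing.Lmodule_isLalgebra.Build R[i] cfun scaleAl.
Let scaleAr (a : R[i]) (f g : cfun) : a *: (f * g) = f * (a *: g).
Proof. by apply: cfunP => x; exact: mulrCA. Qed.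
HB.instance Definition _ := GRing.Lalgebra_isAlgebra.Build R[i] cfun scaleAr.

Definition supnorm f : R := sup (range (fun x => complex.Re `|f x|)).

Let normE (z : C) : `|z| = (complex.Re `|z|)%:C.
Proof. by rewrite normc_def. Qed.

Let Re_ge0 (z : C) : 0 <= complex.Re `|z|.
Proof. by rewrite normc_def/= sqrtr_ge0. Qed.

Let Re_eq0 (z : C) : complex.Re `|z| = 0 -> z = 0.
Proof. exact: Normc.eq0_normc. Qed.

Let ReD (z w : C) : complex.Re `|z + w| <= complex.Re `|z| + complex.Re `|w|.
Proof. by rewrite -lecR rmorphD/= -!normE ler_normD. Qed.

Let ReM (z w : C) : complex.Re `|z * w| = complex.Re `|z| * complex.Re `|w|.
Proof. by apply: complexI; rewrite rmorphM/= -!normE normrM. Qed.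

Lemma supnorm_has_sup f : has_sup (range (fun x => complex.Re `|f x|)).
Proof.
apply: compact_has_sup; first by exists (complex.Re `|f point|), point.
apply: continuous_compact; last exact: space_compact.
apply: continuous_subspaceT => x; apply/cvgrPdist_lt => e e0.
have /cvgrPdist_lt/(_ e%:C) := @cfun_cts f x.
rewrite ltcR => /(_ e0); apply: filterS => y xy.
rewrite -ltcR; apply: le_lt_trans xy.
apply: le_trans (ler_dist_dist _ _).
rewrite (normE (f x)) (normE (f y)) -rmorphB/= normc_def/= expr0n addr0.
by rewrite sqrtr_sqr.
Qed.

Lemma supnorm_ub f x : complex.Re `|f x| <= supnorm f.
Proof. by apply: (ub_le_sup (supnorm_has_sup f).2); exists x. Qed.

Lemma supnorm_le f (e : R) : (forall x, complex.Re `|f x| <= e) -> supnorm f <= e.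
Proof.
move=> h; apply: ge_sup; first exact: (supnorm_has_sup f).1.
by move=> _ [x _ <-].
Qed.

Lemma supnorm_ge0 f : 0 <= supnorm f.
Proof. exact: le_trans (Re_ge0 _) (supnorm_ub f point). Qed.

Let supnormD f g : supnorm (f + g) <= supnorm f + supnorm g.
Proof.
apply: supnorm_le => x; apply: le_trans (ReD _ _) _.
by apply: lerD; exact: supnorm_ub.
Qed.

Let supnormM f g : supnorm (f * g) <= supnorm f * supnorm g.
Proof.
apply: supnorm_le => x; rewrite ReM.
by apply: ler_pM; rewrite ?Re_ge0// supnorm_ub.
Qed.

Let supnormZ (z : R[i]) f : (supnorm (z *: f))%:C = `|z| * (supnorm f)%:C.
Proof.
rewrite (normE z) -rmorphM/=; congr (_ %:C).
apply/eqP; rewrite eq_le; apply/andP; split.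
  apply: supnorm_le => x; rewrite ReM.
  by apply: ler_wpM2l; [exact: Re_ge0|exact: supnorm_ub].
rewrite -[Normc.normc z]/(complex.Re `|z : C|).
have [->|z0] := eqVneq z 0; first by rewrite normr0 mul0r supnorm_ge0.
have r0 : 0 < complex.Re `|z : C|.
  rewrite lt_def Re_ge0 andbT; apply: contra_neq z0; exact: Re_eq0.
rewrite mulrC -ler_pdivlMr//; apply: supnorm_le => x.
rewrite ler_pdivlMr// mulrC -ReM; exact: (supnorm_ub (z *: f) x).
Qed.

Let supnorm_eq0 f : supnorm f = 0 -> f = 0.
Proof.
move=> f0; apply: cfunP => x; apply: Re_eq0.
by apply/eqP; rewrite eq_le Re_ge0 andbT -f0; exact: supnorm_ub.
Qed.

Let starK : involutive cfun_star.
Proof. by move=> f; apply: cfunP => x; exact: conjCK. Qed.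
Let starD : {morph cfun_star : f g / f + g}.
Proof. by move=> f g; apply: cfunP => x; exact: rmorphD. Qed.
Let starZ (z : R[i]) f : cfun_star (z *: f) = z^* *: cfun_star f.
Proof. by apply: cfunP => x; exact: rmorphM. Qed.
Let starM f g : cfun_star (f * g) = cfun_star g * cfun_star f.
Proof. by rewrite mulrC; apply: cfunP => x; exact: rmorphM. Qed.

Let supnorm_starM f : supnorm (cfun_star f * f) = supnorm f ^+ 2.
Proof.
have E x : complex.Re `|(cfun_star f * f) x| = complex.Re `|f x| ^+ 2.
  by rewrite ReM norm_conjC expr2.
apply/eqP; rewrite eq_le; apply/andP; split.
  apply: supnorm_le => x; rewrite E.
  by rewrite ler_sqr ?nnegrE ?supnorm_ge0 ?Re_ge0// supnorm_ub.
rewrite -[leRHS]sqr_sqrtr ?supnorm_ge0//.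
rewrite ler_sqr ?nnegrE ?supnorm_ge0 ?sqrtr_ge0//.
apply: supnorm_le => x.
rewrite -[leLHS]ger0_norm ?Re_ge0// -sqrtr_sqr ler_sqrt ?supnorm_ge0// -E.
exact: supnorm_ub.
Qed.

Let cplx_complete (z : nat -> C) :
  (forall e, 0 < e -> exists N, forall m n, (N <= m)%N -> (N <= n)%N ->
     complex.Re `|z m - z n| < e) ->
  exists l, forall e, 0 < e -> exists N, forall n, (N <= n)%N ->
     complex.Re `|z n - l| < e.
Proof.
move=> zc.
have rc (a : nat -> R) : (forall m n, `|a m - a n| <= complex.Re `|z m - z n|) ->
    exists l, forall e, 0 < e -> exists N, forall n, (N <= n)%N -> `|a n - l| < e.
  move=> az; have : cvg (a @ \oo).
    apply/cauchy_cvgP/cauchy_exP => e e0; have [N hN] := zc e e0.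
    exists (a N), N => // n /= Nn; rewrite /ball/=.
    exact: le_lt_trans (az _ _) (hN _ _ (leqnn N) Nn).
  move=> /cvg_ex[l /cvgrPdist_lt al]; exists l => e /al[N _ hN].
  by exists N => n Nn; rewrite distrC; exact: hN.
have [|a ha] := rc (fun n => complex.Re (z n)).
  move=> m n; rewrite -raddfB normc_def/= -sqrtr_sqr.
  by rewrite ler_wsqrtr// lerDl sqr_ge0.
have [|b hb] := rc (fun n => complex.Im (z n)).
  move=> m n; rewrite -raddfB normc_def/= -sqrtr_sqr.
  by rewrite ler_wsqrtr// lerDr sqr_ge0.
exists (a +i* b) => e e0.
have e20 : 0 < e / 2 by rewrite divr_gt0.
have [N1 h1] := ha _ e20; have [N2 h2] := hb _ e20.
exists (maxn N1 N2) => n; rewrite geq_max => /andP[/h1 {}h1 /h2 {}h2].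
apply: (@le_lt_trans _ _ (`|complex.Re (z n) - a| + `|complex.Im (z n) - b|)).
  move: (z n) {h1 h2} => [x y]; rewrite normc_def/=.
  rewrite -[leRHS]ger0_norm ?addr_ge0// -[leRHS]sqrtr_sqr ler_wsqrtr//.
  rewrite -(real_normK (num_real (x - a))) -(real_normK (num_real (y - b))).
  rewrite [leRHS]sqrrD [leRHS]addrAC lerDl.
  by rewrite mulrn_wge0// mulr_ge0.
by rewrite [e]splitr ltrD.
Qed.

Let supnorm_complete (u : nat -> cfun) :
  (forall e, 0 < e -> exists N, forall m n, (N <= m)%N -> (N <= n)%N ->
     supnorm (u m - u n) < e) ->
  exists l, forall e, 0 < e -> exists N, forall n, (N <= n)%N ->
     supnorm (u n - l) < e.
Proof.
move=> uc.
have /choice[g hg] : forall x, exists l : C, forall e, 0 < e ->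
    exists N, forall n, (N <= n)%N -> complex.Re `|u n x - l| < e.
  move=> x; apply: cplx_complete => e /uc[N hN]; exists N => m n Nm Nn.
  by apply: le_lt_trans (hN _ _ Nm Nn); exact: (supnorm_ub (u m - u n) x).
have ug e : 0 < e -> exists N, forall n, (N <= n)%N ->
    forall x, complex.Re `|u n x - g x| <= e.
  move=> e0; have [N hN] := uc e e0; exists N => n Nn x.
  apply/ler_addgt0Pl => d d0; have [M hM] := hg x d d0.
  rewrite -(subrKA (u (maxn N M) x)) addrC; apply: le_trans (ReD _ _) _.
  rewrite lerD// ltW//; first exact/hM/leq_maxr.
  apply: le_lt_trans (hN _ _ Nn (leq_maxl N M)).
  exact: (supnorm_ub (u n - u (maxn N M)) x).
have gc : continuous (g : X -> C).
  move=> x; apply/cvgrPdist_lt => -[e e']; rewrite ltcE/= => /andP[/eqP-> e0].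
  have e40 : 0 < e / 4 by rewrite divr_gt0.
  have [N hN] := ug _ e40.
  have /cvgrPdist_lt/(_ (e / 4)%:C) := @cfun_cts (u N) x.
  rewrite ltcR => /(_ e40); apply: filterS => y.
  rewrite normE ltcR => xy.
  rewrite normE -/(e%:C) ltcR.
  have -> : g x - g y = (g x - u N x) + (u N x - u N y) + (u N y - g y).
    by rewrite subrKA subrKA.
  apply: le_lt_trans (ReD _ _) _.
  apply: (@le_lt_trans _ _ (e / 4 + e / 4 + e / 4)); last by lra.
  apply: lerD; last exact: hN.
  apply: le_trans (ReD _ _) _; apply: lerD; last exact: ltW.
  by rewrite distrC; exact: hN.
exists (mkcfun gc) => e e0; have e20 : 0 < e / 2 by rewrite divr_gt0.
have [N hN] := ug _ e20; exists N => n Nn.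
apply: (@le_lt_trans _ _ (e / 2)); last by lra.
by apply: supnorm_le => x; exact: hN.
Qed.

HB.instance Definition _ := isCStarAlgebra.Build R cfun supnormD supnormZ
  supnorm_eq0 supnormM supnorm_complete starK starD starZ starM supnorm_starM.

End CX.

(* Num.int_num_subdef is the predicate underlying Num.int. *)
Definition integers (R : realType) : zmodClosed R :=
  GRing.ZmodClosed.clone R (@Num.int_num_subdef R) _.

(* R/Z with the quotient topology and the quotient group structure. *)
Definition circle (R : realType) : Type :=
  quotient_topology (Quotient.quot (integers R)).

Section circle.
Variable R : realType.
Local Notation T := (circle R).
Local Notation Q := (Quotient.quot (integers R)).

HB.instance Definition _ := PointedTopological.copy T (quotient_topology Q).
HB.instance Definition _ := Quotient.copy T (quotient_topology Q).
HB.instance Definition _ := GRing.isZmodule.Build T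
  (@Quotient.addqA R (integers R)) (@Quotient.addqC R (integers R))
  (@Quotient.add0q R (integers R)) (@Quotient.addNq R (integers R)).

Definition circle_pi (t : R) : T := \pi_T%qT t.

Lemma circle_piB (s t : R) : circle_pi (s - t) = circle_pi s - circle_pi t.
Proof. exact: (raddfB \pi_Q%qT). Qed.

Lemma circle_pi_eq (s t : R) :
  (circle_pi s = circle_pi t) <-> (s - t \is a Num.int).
Proof.
split => st.
  suff : s - t \in integers R by [].
  by rewrite Quotient.idealrBE; apply/eqP; exact: st.
have : s - t \in integers R by [].
by rewrite Quotient.idealrBE => /eqP.
Qed.

Lemma circle_pi_continuous : continuous circle_pi.
Proof. exact: (@pi_continuous R Q). Qed.

Lemma circle_continuous (Z : topologicalType) (f : T -> Z) :
  continuous (f \o circle_pi) -> continuous f.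
Proof. by move=> fc; apply/(@quotient_continuous R Q Z f). Qed.

Let circle_compact : compact [set: T].
Proof.
have -> : [set: T] = circle_pi @` `[0, 1]%classic.
  apply/seteqP; split => // x _; exists (repr x - (Num.floor (repr x))%:~R).
    rewrite /= in_itv/=; have := Num.Theory.real_floor_itv (num_real (repr x)).
    by rewrite rmorphD/=; lra.
  rewrite -[RHS](reprK x); apply/circle_pi_eq.
  by rewrite addrAC subrr sub0r rpredN; exact: intr_int.
apply: continuous_compact; last exact: segment_compact.
by apply: continuous_subspaceT; exact: circle_pi_continuous.
Qed.
HB.instance Definition _ := isCompactSpace.Build T circle_compact.

End circle.

Section rotation.
Variables (R : realType) (theta : R).
Local Notation T := (circle R).
Local Notation CT := (cfun R T).

Let rot_cts (f : CT) : continuous (fun x : T => f (x - circle_pi theta)).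
Proof.
apply: circle_continuous.
rewrite (_ : _ \o _ = (f \o @circle_pi R) \o (fun s => s - theta)); last first.
  by apply/funext => s /=; rewrite circle_piB.
move=> s; apply: (@continuous_comp R R R[i]^o).
  by apply: cvgB; [exact: cvg_id|exact: cvg_cst].
apply: (@continuous_comp R T R[i]^o); first exact: circle_pi_continuous.
exact: cfun_cts.
Qed.

(* The rotation of T by theta: (rotate f)(x) = f(x - theta). *)
Definition rotate (f : CT) : CT := mkcfun (@rot_cts f).

Let rotate_linear : linear rotate.
Proof. by move=> a f g; apply: cfunP. Qed.
HB.instance Definition _ :=
  GRing.isLinear.Build R[i] CT CT *:%R rotate rotate_linear.
Let rotate_monoid : monoid_morphism rotate.
Proof. by split=> [|f g]; apply: cfunP. Qed.
HB.instance Definition _ := GRing.isMonoidMorphism.Build CT CT rotate rotate_monoid.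

End rotation.

Section rotation_aut.
Variables (R : realType) (theta : R).
Local Notation CT := (cfun R (circle R)).

Let rotate_star (f : CT) : rotate theta (cstar f) = cstar (rotate theta f).
Proof. exact: cfunP. Qed.

Let rotateK (t : R) : cancel (@rotate R t) (@rotate R (- t)).
Proof.
move=> f; apply: cfunP => x /=; congr (f _).
have pi0 : circle_pi (0 : R) = 0 by rewrite -(subrr 0) circle_piB subrr.
by rewrite -[- t]sub0r circle_piB pi0 sub0r opprK addrK.
Qed.

Let rotate_bij : bijective (rotate theta).
Proof.
exists (rotate (- theta)); first exact: (@rotateK).
by rewrite -{2}[theta]opprK; exact: (@rotateK).
Qed.

Definition rotation : cstar_aut (cfun R (circle R)) :=
  CStarAut rotate_star rotate_bij.
End rotation_aut.

(* Main.v *)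
Require Import Defs.
From mathcomp Require Import all_boot all_order all_algebra.
From mathcomp Require Import all_classical all_reals topology normedtype.
From mathcomp Require Import complex ring lra zify.
Set Implicit Arguments.
Unset Strict Implicit.
Unset Printing Implicit Defensive.
Import Order.TTheory GRing.Theory Num.Theory.
Import numFieldTopology.Exports numFieldNormedType.Exports.
Local Open Scope classical_set_scope.
Local Open Scope complex_scope.
Local Open Scope ring_scope.

(* Lower bound: if d = 0 and p = 2, the elements of the unique nonzero tower are
   almost orthogonal and sum up to almost 1, so at each point exactly one of
   them is close to 1.  As the circle is connected, it is the same one at every
   point, which contradicts that the rotation permutes them.

   Upper bound: all towers have height p.  The circle is covered by 2p tents
   of half-width 1/(2p) centred at the multiples of 1/(2p), which form a
   partition of unity; the even and the odd ones make the two levels.  Choose an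
   integer k with k theta close to 1/p modulo 1, and compose the tents with
   x |-> k x.  Then alpha shifts them by almost 1/p, hence permutes each level
   cyclically. *)

(** * Distance to the nearest integer, and periodic tent functions *)

Section dist_int.
Variable R : realType.
Implicit Types s t r : R.

Definition dist_int t : R := `|t - (Num.floor (t + 2^-1))%:~R|.

Lemma dist_int_le_half t : dist_int t <= 2^-1.
Proof.
have := floor_itv (t + 2^-1); rewrite intrD /dist_int.
by move=> /andP[h1 h2]; rewrite ler_norml; apply/andP; split; lra.
Qed.

(** Rounding puts t within 1/2 of floor(t + 1/2), and every other integer is then at distance at
    least 1/2. *)
Lemma dist_int_le t (k : int) : dist_int t <= `|t - k%:~R|.
Proof.
have [->|kf] := eqVneq k (Num.floor (t + 2^-1)); first by [].
apply: le_trans (dist_int_le_half t) _.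
set m := Num.floor _ in kf *.
have := floor_itv (t + 2^-1); rewrite -/m intrD => /andP[h1 h2].
have : k <= m - 1 \/ m + 1 <= k by lia.
rewrite -!(ler_int R) !intrD ler_normr => -[h|h]; apply/orP; [left|right]; lra.
Qed.

Lemma dist_int_ge0 t : 0 <= dist_int t. Proof. exact: normr_ge0. Qed.

Lemma dist_int_eq t (k : int) : `|t - k%:~R| <= 2^-1 -> dist_int t = `|t - k%:~R|.
Proof.
move=> h; apply/eqP; rewrite eq_le dist_int_le/=.
have [->|kf] := eqVneq k (Num.floor (t + 2^-1)); first by [].
apply: (le_trans h); rewrite /dist_int.
set m := Num.floor _ in kf *.
have : k <= m - 1 \/ m + 1 <= k by lia.
move: h; rewrite -!(ler_int R) !intrD ler_norml ler_normr.
by move=> /andP[h1 h2] [h|h]; apply/orP; [right|left]; lra.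
Qed.

Lemma dist_intN t : dist_int (- t) = dist_int t.
Proof.
have h u : dist_int (- u) <= dist_int u.
  apply: (le_trans (dist_int_le _ (- Num.floor (u + 2^-1)))).
  by rewrite intrN -opprD normrN.
by apply/eqP; rewrite eq_le h/= -{1}[t]opprK h.
Qed.

Lemma dist_intD_le s t : dist_int (s + t) <= dist_int s + dist_int t.
Proof.
apply: le_trans (dist_int_le _ (Num.floor (s + 2^-1) + Num.floor (t + 2^-1))) _.
rewrite (_ : _ - _ = (s - (Num.floor (s + 2^-1))%:~R)
  + (t - (Num.floor (t + 2^-1))%:~R)); first exact: ler_normD.
by rewrite intrD; ring.
Qed.

Lemma dist_intB_le s t : dist_int (s - t) <= dist_int s + dist_int t.
Proof. by rewrite -(dist_intN t) dist_intD_le. Qed.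

Lemma dist_int_le_norm t : dist_int t <= `|t|.
Proof. by rewrite (le_trans (dist_int_le t 0))// subr0. Qed.

Definition tent (n : nat) t : R := Num.max 0 (1 - n%:R * dist_int t).

Lemma tent_ge0 n t : 0 <= tent n t.
Proof. by rewrite /tent le_max lexx. Qed.

Lemma dist_intDz t (k : int) : dist_int (t + k%:~R) = dist_int t.
Proof.
rewrite /dist_int (addrAC t _ 2^-1) floorDrz; last exact: intr_int.
rewrite intrD (@floorK _ k%:~R) ?intr_int//.
by congr `| _ |; ring.
Qed.

Lemma tentDz n t (k : int) : tent n (t + k%:~R) = tent n t.
Proof. by rewrite /tent dist_intDz. Qed.

Lemma tent_lip n s t : `|tent n s - tent n t| <= n%:R * dist_int (s - t).
Proof.
have h u v : dist_int u <= dist_int v + dist_int (u - v).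
  by rewrite -{1}(subrK v u) addrC dist_intD_le.
have h1 := h s t; have h2 := h t s.
rewrite -(dist_intN (t - s)) opprB in h2.
have n0 : 0 <= n%:R :> R by [].
have h4 := ler_wpM2l n0 h1; have h5 := ler_wpM2l n0 h2.
rewrite mulrDr in h4; rewrite mulrDr in h5.
have h6 : 0 <= n%:R * dist_int (s - t) by rewrite mulr_ge0// dist_int_ge0.
rewrite /tent ler_norml; move: h4 h5 h6.
case: (lerP 0 (1 - n%:R * dist_int s)); case: (lerP 0 (1 - n%:R * dist_int t)).
all: by lra.
Qed.

Lemma tent_gt0 n t : (0 < n)%N -> 0 < tent n t -> dist_int t < n%:R^-1.
Proof.
move=> n0; rewrite /tent lt_max ltxx/= subr_gt0.
by rewrite -ltr_pdivlMl ?ltr0n// mulr1.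
Qed.

(** b/n - k is a nonzero integer divided by n. This later separates the tents of one level. *)
Lemma dist_int_ge n (b : int) : (0 < n)%N -> ~~ (n%:Z %| b)%Z ->
  n%:R^-1 <= dist_int (b%:~R / n%:R).
Proof.
move=> n0 nb; rewrite /dist_int; set k := Num.floor _.
have n0' : 0 < n%:R :> R by rewrite ltr0n.
have -> : b%:~R / n%:R - k%:~R = (b - k * n)%:~R / n%:R :> R.
  by rewrite intrB intrM; field; lra.
rewrite normrM normfV (ger0_norm (ltW n0')) ler_pMl ?invr_gt0//.
apply: norm_intr_ge1; first exact: intr_int.
rewrite intr_eq0; apply: contra nb; rewrite subr_eq0 => /eqP ->.
exact: dvdz_mull.
Qed.

(** As 1 < n, |t/n| is at most 1/2, so k is an integer nearest to t/n + k and the maximum in [tent]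
    is its second argument. *)
Lemma tent_near n (k : int) t : (1 < n)%N -> `|t| <= 1 ->
  tent n (t / n%:R + k%:~R) = 1 - `|t|.
Proof.
move=> n1 t1; have n0 : 0 < n%:R :> R by rewrite ltr0n ltnW.
have i2 : n%:R^-1 <= 2^-1 :> R by rewrite lef_pV2 ?posrE// ler_nat.
have tn : `|t / n%:R| = `|t| / n%:R by rewrite normrM normfV (ger0_norm (ltW n0)).
have -> : tent n (t / n%:R + k%:~R) = Num.max 0 (1 - n%:R * `|t / n%:R|).
  rewrite tentDz /tent (@dist_int_eq _ 0) subr0// tn (le_trans _ i2)//.
  by rewrite ler_piMl// invr_ge0 ltW.
rewrite tn mulrCA divff ?lt0r_neq0// mulr1.
by apply/max_idPr; rewrite subr_ge0.
Qed.

(** Between consecutive multiples of 1/n the tent is affine, so it interpolates its values at b/n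
    and (b+1)/n; these are 1 at integers and 0 elsewhere. *)
Lemma tent_step n (b : int) r : (1 < n)%N -> 0 <= r < 1 ->
  tent n ((b%:~R + r) / n%:R) =
  (1 - r) * (n%:Z %| b)%Z%:R + r * (n%:Z %| b + 1)%Z%:R.
Proof.
move=> n1 /andP[r0 r1]; have n0 : 0 < n%:R :> R by rewrite ltr0n ltnW.
have [/dvdzP[k bk]|nb] := boolP (n%:Z %| b)%Z.
  have /negbTE -> : ~~ (n%:Z %| b + 1)%Z.
    apply/negP => /dvdzP[j]; rewrite bk => E.
    have [?|?] : j - k <= 0 \/ 1 <= j - k by lia.
      nia.
    nia.
  rewrite mulr1 mulr0 addr0 bk.
  rewrite (_ : _ / _ = r / n%:R + k%:~R); last by rewrite intrM; field; lra.
  by rewrite tent_near// ger0_norm//; lra.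
have [/dvdzP[k bk]|nb1] := boolP (n%:Z %| b + 1)%Z.
  rewrite mulr0 mulr1 add0r.
  rewrite (_ : _ / _ = (r - 1) / n%:R + k%:~R); last first.
    by rewrite (_ : b = k * n - 1) ?intrB ?intrM; [field; lra|lia].
  by rewrite tent_near// ler0_norm//; lra.
rewrite !mulr0 addr0; apply/max_idPl; rewrite subr_le0 -ler_pdivrMl// mulr1.
rewrite /dist_int; set k := Num.floor _.
rewrite (_ : _ - _ = ((b - k * n)%:~R + r) / n%:R); last first.
  by rewrite intrB intrM; field; lra.
rewrite normrM normfV (ger0_norm (ltW n0)) ler_pMl ?invr_gt0//.
(* b - kn is neither 0 nor -1, so adding r in [0,1) leaves an absolute value of at least 1, where
   the tent vanishes. *)
have : b - k * n + 2 <= 0 \/ 1 <= b - k * n.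
  have : b != k * n by apply: contraNneq nb => ->; exact: dvdz_mull.
  have : b + 1 != k * n by apply: contraNneq nb1 => ->; exact: dvdz_mull.
  lia.
rewrite -!(ler_int R) ler_normr intrD => -[h|h]; apply/orP; [right|left]; lra.
Qed.

(** Exactly one m below n is congruent to a modulo n, namely the remainder of a. *)
Lemma sum_dvdz n (a : int) : (0 < n)%N ->
  \sum_(m < n) (n%:Z %| a - m%:Z)%Z%:R = 1 :> R.
Proof.
move=> n0; have nz : n%:Z != 0 by lia.
have n0z : 0 < n%:Z by lia.
have an : (`|(a %% n)%Z| < n)%N.
  by have := modz_ge0 a nz; have := ltz_pmod a n0z; lia.
rewrite (bigD1 (Ordinal an))//= big1 ?addr0 => [|m mn].
  rewrite gez0_abs ?modz_ge0// {1}(divz_eq a n) addrK dvdz_mull//.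
rewrite (_ : (_ %| _)%Z = false)//; apply/negbTE; apply: contra mn.
rewrite -eqz_mod_dvd => /eqP h; apply/eqP/val_inj => /=.
by rewrite h modz_small//=; have := ltn_ord m; lia.
Qed.

Lemma sum_tent n t : (1 < n)%N -> \sum_(m < n) tent n (t - m%:R / n%:R) = 1.
Proof.
move=> n1; have n0 : 0 < n%:R :> R by rewrite ltr0n ltnW.
(* With nt = a + r, [tent_step] splits the sum into 1 - r times one sum of divisibility indicators
   plus r times another, and both sums are 1. *)
set a := Num.floor (n%:R * t); pose r := n%:R * t - a%:~R.
have r01 : 0 <= r < 1.
  have := floor_itv (n%:R * t); rewrite -/a /r intrD => /andP[h1 h2].
  by apply/andP; split; lra.
under eq_bigr => m _.
  rewrite (_ : _ - _ = ((a - m%:Z)%:~R + r) / n%:R); last first.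
    by rewrite /r intrB; field; lra.
  rewrite tent_step// addrAC.
  over.
by rewrite big_split/= -!mulr_sumr !sum_dvdz ?(ltnW n1)//; ring.
Qed.

End dist_int.

(** * Density of the integer multiples of an irrational number modulo 1 *)

Section kronecker.
Variable R : realType.

(** Dirichlet's pigeonhole argument: two of M + 2 fractional parts of multiples of theta share one
    of M + 1 boxes of length 1/(M+1) < d. Irrationality keeps them distinct. *)
Lemma irrational_approx (theta d : R) : irrational theta -> 0 < d ->
  exists q a : int, 0 < `|q%:~R * theta - a%:~R| < d.
Proof.
move=> irr_theta d0; pose M := Num.bound d^-1.
have M0 : 0 < M.+1%:R :> R by rewrite ltr0n.
have Md : M.+1%:R^-1 < d.
  rewrite invf_plt ?posrE//; apply: (@lt_trans _ _ M%:R); last by rewrite ltr_nat.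
  by apply: archi_boundP; rewrite invr_ge0 ltW.
pose fl (i : nat) := Num.floor (i%:R * theta).
pose x (i : nat) : R := i%:R * theta - (fl i)%:~R.
have x01 i : 0 <= x i < 1.
  have := floor_itv (i%:R * theta); rewrite -/(fl i) /x intrD.
  by move=> /andP[h1 h2]; apply/andP; split; lra.
have box i : 0 <= Num.floor (M.+1%:R * x i) < M.+1%:Z.
  have /andP[x0 x1] := x01 i.
  rewrite floor_ge0 mulr_ge0 ?(ltW M0)//= floor_lt_int.
  by rewrite -[ltRHS]mulr1 ltr_pM2l.
(* By [box] the argument of [inord] is in range, so its default value never occurs. *)
pose f (i : 'I_M.+2) : 'I_M.+1 := inord `|Num.floor (M.+1%:R * x i)|%N.
have /injectivePn[i [j ij fij]] : ~~ injectiveb f.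
  by apply/negP => /injectiveP/leq_card; rewrite !card_ord ltnn.
have {}fij : Num.floor (M.+1%:R * x i) = Num.floor (M.+1%:R * x j).
  move/(congr1 val): fij; have := box i; have := box j.
  by rewrite /f /= => bj bi; rewrite !inordK; lia.
exists (i%:Z - j%:Z), (fl i - fl j).
have -> : (i%:Z - j%:Z)%:~R * theta - (fl i - fl j)%:~R = x i - x j.
  by rewrite !intrB /x; ring.
apply/andP; split.
  rewrite normr_gt0 /x; apply/eqP => E; apply: irr_theta.
  have ij0 : i%:Z - j%:Z != 0.
    by apply: contra ij => /eqP ?; apply/eqP/val_inj => /=; lia.
  have ij1 : (i%:Z - j%:Z)%:~R != 0 :> R by rewrite intr_eq0.
  exists ((fl i - fl j)%:Q / (i%:Z - j%:Z)%:Q) => //.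
  rewrite fmorph_div/= !ratr_int; apply: (mulIf ij1).
  by rewrite divfK// !intrB; move: E; rewrite -[i%:~R]/(i%:R) -[j%:~R]/(j%:R); lra.
apply: le_lt_trans Md; rewrite -[leRHS]mul1r ler_pdivlMr//.
have := floor_itv (M.+1%:R * x i); have := floor_itv (M.+1%:R * x j).
rewrite -fij intrD => /andP[h1 h2] /andP[h3 h4].
rewrite -[X in _ * X](ger0_norm (ltW M0)) -normrM ler_norml.
by apply/andP; split; lra.
Qed.

Lemma irrational_dense_mod1 (theta c d : R) : irrational theta -> 0 < d ->
  exists k : int, dist_int (k%:~R * theta - c) < d.
Proof.
move=> irr d0; have [q [a /andP[h0 hd]]] := irrational_approx irr d0.
set h := q%:~R * theta - a%:~R in h0 hd.
have hn : h != 0 by rewrite -normr_gt0.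
(* Modulo 1, qm theta equals mh, and this choice of m brings mh within |h| < d of c. *)
pose m := Num.floor (c / h); exists (q * m).
apply: le_lt_trans (dist_int_le _ (a * m)) _.
rewrite (_ : _ - _ = (m%:~R - c / h) * h); last first.
  by rewrite mulrBl divfK// !intrM /h; ring.
rewrite normrM; apply: le_lt_trans hd; rewrite ler_piMl//.
have := floor_itv (c / h); rewrite -/m intrD ler_norml => /andP[h1 h2].
by apply/andP; split; lra.
Qed.

End kronecker.

(** * Norm and positivity in C(X), read off pointwise *)

Section cfun_theory.
Variables (R : realType) (X : compactSpaceType).
Local Notation C := (R[i]^o).
Implicit Types f : cfun R X.

Lemma cfun_sumE (I : Type) (r : seq I) (P : pred I) (F : I -> cfun R X) x :
  (\sum_(i <- r | P i) F i : cfun R X) x = \sum_(i <- r | P i) (F i x : R[i]).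
Proof. exact: (big_morph (fun f : cfun R X => f x : R[i])). Qed.

Lemma cnorm_lt f (e : R) : 0 < e ->
  (forall x, complex.Re `|f x| <= e / 2) -> cnorm f < e.
Proof.
move=> e0 h; apply: (@le_lt_trans _ _ (e / 2)); last by lra.
exact: (supnorm_le h).
Qed.

Lemma cnorm_ub f x : complex.Re `|f x| <= cnorm f.
Proof. exact: supnorm_ub. Qed.

(** The spectrum of f is its range: f - f(x) vanishes at x, so it has no inverse, while for z
    outside the range 1/(f - z) is continuous. *)
Lemma cfun_positive f : positive_elt f <-> forall x, 0 <= (f x : R[i]).
Proof.
split=> [[_ sp] x|f0].
  apply: sp => -[b [fb _]].
  have := congr1 (fun g : cfun R X => g x : R[i]) fb.
  rewrite -[LHS]/((f x - f x * 1) * b x : R[i]) -[RHS]/(1 : R[i]).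
  by rewrite mulr1 subrr mul0r => /eqP; rewrite eq_sym oner_eq0.
split.
  by apply: cfunP => x; exact: (geC0_conj (f0 x)).
move=> z; apply: contra_notP => nz.
have fz x : (f x : R[i]) - z != 0.
  by apply/eqP => /eqP; rewrite subr_eq0 => /eqP E; apply: nz; rewrite -E.
have ic : continuous (fun x => (f x - z)^-1 : C).
  move=> x; apply: (@cvgV R[i]); first exact: fz.
  by apply: cvgB; [exact: cfun_cts|exact: cvg_cst].
exists (mkcfun ic); split; apply: cfunP => x.
  rewrite -[LHS]/(((f x : R[i]) - z * 1) * (f x - z)^-1) mulr1; exact: mulfV.
rewrite -[LHS]/((f x - z)^-1 * ((f x : R[i]) - z * 1)) mulr1; exact: mulVf.
Qed.
End cfun_theory.

(** * Tents on the circle and the upper bound *)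

Section circle_tent.
Variable R : realType.
Local Notation C := (R[i]^o).

Lemma circle_piK (x : circle R) : circle_pi (repr x) = x.
Proof. exact: reprK. Qed.

(** The tent centred at c, pulled back along multiplication by k. As k is an integer and [tent] has
    period 1, the choice of representative does not matter. *)
Definition circle_tent_fun (n : nat) (k : int) (c : R) (x : circle R) : C :=
  (tent n (k%:~R * repr x - c))%:C.

Lemma circle_tent_funE n k c s :
  circle_tent_fun n k c (circle_pi s) = (tent n (k%:~R * s - c))%:C.
Proof.
have /circle_pi_eq/intrP[m sm] := circle_piK (circle_pi s).
rewrite /circle_tent_fun -(tentDz n (k%:~R * s - c) (k * m)).
congr (tent n _)%:C; rewrite intrM -sm; ring.
Qed.

Lemma tent_continuous n : continuous (@tent R n).
Proof.
move=> x; apply/cvgrPdist_lt => e e0.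
(* The denominator n + 1 in place of the Lipschitz constant n also covers n = 0. *)
have d0 : 0 < e / n.+1%:R by rewrite divr_gt0.
near=> y.
apply: le_lt_trans (tent_lip n x y) _.
apply: le_lt_trans (ler_wpM2l _ (dist_int_le_norm (x - y))) _ => //.
have h : `|x - y| < e / n.+1%:R by near: y; exact: cvgr_dist_lt.
apply: (@le_lt_trans _ _ (n.+1%:R * `|x - y|)).
  by rewrite ler_wpM2r// ler_nat.
by rewrite mulrC -ltr_pdivlMr.
Unshelve. all: by end_near. Qed.

Lemma real_complex_continuous : continuous (fun t : R => t%:C : C).
Proof.
move=> x; apply/cvgrPdist_lt => -[e e']; rewrite ltcE/= => /andP[/eqP-> e0].
near=> y.
rewrite -rmorphB/= normc_def/= expr0n addr0 sqrtr_sqr -/(e%:C) ltcR.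
by near: y; exact: cvgr_dist_lt.
Unshelve. all: by end_near. Qed.


Lemma circle_tent_continuous n k c : continuous (circle_tent_fun n k c).
Proof.
apply: circle_continuous.
rewrite (_ : _ \o _ = (fun t : R => t%:C : C) \o
    (@tent R n \o (fun s => k%:~R * s - c))); last first.
  by apply/funext => s; exact: circle_tent_funE.
move=> s; apply: (@continuous_comp R R C); last exact: real_complex_continuous.
apply: continuous_comp; last exact: tent_continuous.
by apply: cvgB; [exact: mulrl_continuous|exact: cvg_cst].
Qed.

Definition circle_tent n k c : cfun R (circle R) :=
  mkcfun (@circle_tent_continuous n k c).

Lemma circle_tentE n k c s :
  circle_tent n k c (circle_pi s) = (tent n (k%:~R * s - c))%:C :> R[i].
Proof. exact: circle_tent_funE. Qed.

(** If both factors were positive, s and t would each lie within 1/n of an integer, hence s - t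
    strictly within 2/n of one. *)
Lemma tentM_eq0 n (s t : R) : (0 < n)%N -> 2 / n%:R <= dist_int (s - t) ->
  tent n s * tent n t = 0.
Proof.
move=> n0 st; apply/eqP; rewrite mulf_eq0; apply/negPn/negP => /norP[hs ht].
have {}hs : 0 < tent n s by rewrite lt_def hs tent_ge0.
have {}ht : 0 < tent n t by rewrite lt_def ht tent_ge0.
have := tent_gt0 n0 hs; have := tent_gt0 n0 ht; have := dist_intB_le s t.
by move: st; rewrite mulrDl mul1r; lra.
Qed.

Lemma circle_tentM_eq0 n k c c' : (0 < n)%N -> 2 / n%:R <= dist_int (c' - c) ->
  circle_tent n k c * circle_tent n k c' = 0.
Proof.
move=> n0 cc; apply: cfunP => x; rewrite -(circle_piK x).
rewrite -[LHS]/(circle_tent n k c (circle_pi (repr x)) *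
  circle_tent n k c' (circle_pi (repr x)) : R[i]) !circle_tentE -rmorphM/=.
rewrite tentM_eq0//; apply: le_trans cc _.
by rewrite (_ : c' - c = k%:~R * repr x - c - (k%:~R * repr x - c')) //; ring.
Qed.

Lemma circle_tent_positive n k c : positive_elt (circle_tent n k c).
Proof.
apply/cfun_positive => x; rewrite -(circle_piK x) circle_tentE.
by rewrite lecR tent_ge0.
Qed.

Lemma Re_norm_real (t : R) : complex.Re `|t%:C : C| = `|t|.
Proof. by rewrite normc_def/= expr0n addr0 sqrtr_sqr. Qed.

(** In the coordinate kx the rotation moves the centre c by k theta, and tents are n-Lipschitz. The
    integer z absorbs the wrap-around from the top of a tower to its bottom. *)
Lemma cnorm_rotation_circle_tent (theta : R) n k c c' (z : int) e :
  0 < e -> n%:R * dist_int (k%:~R * theta - (c' - c + z%:~R)) <= e / 2 ->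
  cnorm (rotation theta (circle_tent n k c) - circle_tent n k c') < e.
Proof.
move=> e0 he; apply: cnorm_lt => // x; rewrite -(circle_piK x).
set s := repr x.
have -> : (rotation theta (circle_tent n k c) - circle_tent n k c') (circle_pi s)
    = (tent n (k%:~R * (s - theta) - c) - tent n (k%:~R * s - c'))%:C :> R[i].
  by rewrite rmorphB/= -!circle_tentE circle_piB.
rewrite Re_norm_real.
rewrite -(tentDz n (_ - c') (- z)).
apply: le_trans (tent_lip _ _ _) (le_trans _ he).
rewrite -(dist_intN (_ - (_ + _))).
by rewrite intrN (_ : - _ = k%:~R * theta - (c' - c + z%:~R)) //; ring.
Qed.

Lemma even_shift_diff (p l i j : nat) : (0 < p)%N ->
  (2 * j + l)%N%:R / (2 * p)%N%:R - (2 * i + l)%N%:R / (2 * p)%N%:R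
  = (j%:R - i%:R) / p%:R :> R.
Proof.
move=> p0; have p0' : 0 < p%:R :> R by rewrite ltr0n.
by rewrite !natrD ?natrM; field; lra.
Qed.

Lemma sum_even_odd (V : nmodType) p (F : nat -> V) :
  \sum_(j < p) F (2 * j + 0)%N + \sum_(j < p) F (2 * j + 1)%N =
  \sum_(m < 2 * p) F m.
Proof.
elim: p => [|p IH]; first by rewrite muln0 !big_ord0 addr0.
rewrite (_ : 2 * p.+1 = (2 * p).+2)%N ?mulnS// !big_ord_recr/= -IH addn0 addn1.
by rewrite !addrA; congr (_ + _); rewrite addrAC.
Qed.

Lemma rotation_has_single_towers (theta : R) : irrational theta ->
  has_single_towers (rotation theta) 1.
Proof.
move=> irr F p e _ p0 e0.
have p0' : 0 < p%:R :> R by rewrite ltr0n.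
set n := (2 * p)%N.
have n1 : (1 < n)%N by rewrite /n; lia.
have n0 : 0 < n%:R :> R by rewrite ltr0n ltnW.
(* Division by n pays for the Lipschitz constant of the tents; the factor 1/2 is the slack required
   by [cnorm_lt]. *)
have en0 : 0 < e / 2 / n%:R by rewrite !divr_gt0.
have [k hk] := irrational_dense_mod1 p%:R^-1 irr en0.
(* Level 0 takes the even multiples of 1/n and level 1 the odd ones, so neighbouring centres of a
   level are 2/n = 1/p apart. *)
pose c (l j : nat) : R := (2 * j + l)%N%:R / n%:R.
pose f (l : 'I_2) (r : 'I_2) (j : nat) : cfun R (circle R) :=
  if r == 0 then circle_tent n k (c l j) else 0.
have f0 l j : f l 0 j = circle_tent n k (c l j) by [].
have f1 l j : f l 1 j = 0 by [].
have cn0 : cnorm (0 : cfun R (circle R)) < e.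
  by apply: cnorm_lt => // x; rewrite normr0/=; lra.
have kn : n%:R * dist_int (k%:~R * theta - p%:R^-1) <= e / 2.
  by rewrite mulrC -ler_pdivlMr// ltW.
have r2 (r : 'I_2) : r = 0 \/ r = 1.
  by case: r => [[|[|//]]] ?; [left|right]; exact/val_inj.
exists f; split.
- move=> l r j _; have [->|->] := r2 r; first exact: circle_tent_positive.
  by rewrite f1; apply/cfun_positive => x; exact: lexx.
- by move=> l; exists 1 => j _; rewrite f1.
split.
- move=> l q r i j.
  have [->|->] := r2 q; last by rewrite f1 mul0r.
  have [->|->] := r2 r; last by rewrite f1 mulr0.
  rewrite !addn0 => ip jp ij; rewrite !f0 circle_tentM_eq0// ?(ltnW n1)//.
  have -> : c l j - c l i = (j%:Z - i%:Z)%:~R / p%:R.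
    by rewrite intrB -!pmulrn /c even_shift_diff.
  (* The required gap 2/n is 1/p, and p cannot divide j - i because i and j are distinct and below
     p. *)
  rewrite {1}/n natrM invfM mulrA divff ?pnatr_eq0// mul1r.
  apply: dist_int_ge => //; apply/negP => /dvdzP[m hm].
  have : i <> j by move=> E; apply: ij; rewrite E.
  have [?|[?|?]] : m <= -1 \/ m = 0 \/ 1 <= m by lia.
  - nia.
  - by subst m; lia.
  - nia.
- rewrite (_ : _ - 1 = 0)//; apply: cfunP => x.
  rewrite -[LHS]/((\sum_(l < 2) \sum_(r < 2) \sum_(j < p + r) f l r j
    : cfun R (circle R)) x - 1 : R[i]) -[RHS]/(0 : R[i]).
  apply/eqP; rewrite subr_eq0; apply/eqP; rewrite cfun_sumE.
  pose t m : R[i] := (tent n (k%:~R * repr x - m%:R / n%:R))%:C.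
  transitivity (\sum_(l < 2) \sum_(j < p) t (2 * j + l)%N).
    apply: eq_bigr => l _; rewrite big_ord_recl big_ord1.
    rewrite (_ : lift ord0 ord0 = 1 :> 'I_2); last exact/val_inj.
    rewrite [X in _ + X]big1 => [|j _]; last exact: f1.
    rewrite addr0 cfun_sumE addn0; apply: eq_bigr => j _.
    by rewrite f0 -{1}(circle_piK x) circle_tentE.
  (* The two levels together are all n tents, which form a partition of unity. *)
  rewrite big_ord_recl big_ord1 sum_even_odd -rmorph_sum/=.
  by rewrite sum_tent.
- move=> l r j; have [->|->] := r2 r; last first.
    by rewrite !f1 raddf0 subrr.
  rewrite addn0 => jp; rewrite !f0.
  apply: (@cnorm_rotation_circle_tent _ _ _ _ _ 0) => //.
  by rewrite addr0 /c even_shift_diff// -natr1 addrAC subrr add0r mul1r.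
- move=> l; rewrite !f1 !addr0 !f0.
  (* From the last centre to the first, one full turn is added: -(p-1)/p + 1 = 1/p. *)
  apply: (@cnorm_rotation_circle_tent _ _ _ _ _ 1) => //.
  rewrite (_ : c l 0 - c l p.-1 + 1%:~R = p%:R^-1)//.
  rewrite /c even_shift_diff// (_ : p.-1%:R = p%:R - 1); first by field; lra.
  by rewrite -{2}(prednK p0) -natr1 addrK.
- by move=> l r j a _ _; rewrite mulrC subrr.
Qed.
End circle_tent.

(** * Connectedness of the circle and the lower bound *)

Section lower.
Variable R : realType.
Implicit Types f g : cfun R (circle R).

Lemma Re_cfun_continuous (X : compactSpaceType) (f : cfun R X) :
  continuous (fun x => complex.Re (f x) : R).
Proof.
move=> x; apply/cvgrPdist_lt => e e0.
have /cvgrPdist_lt/(_ e%:C) := @cfun_cts R X f x.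
rewrite ltcR => /(_ e0); apply: filterS => y; rewrite -ltcR.
by apply: le_lt_trans; rewrite -raddfB/=; exact: normc_ge_Re.
Qed.

Lemma Re_cfun_le f x : `|complex.Re (f x)| <= cnorm f.
Proof.
apply: le_trans (cnorm_ub f x); rewrite -lecR.
by apply: le_trans (normc_ge_Re _) _; rewrite normc_def.
Qed.

Lemma positive_Re f x : positive_elt f ->
  0 <= complex.Re (f x) /\ f x = (complex.Re (f x))%:C :> R[i].
Proof.
move=> /cfun_positive/(_ x); case: (f x) => a b.
by rewrite lecE/= => /andP[/eqP-> a0].
Qed.

Lemma Re_cfunM_le f g x : positive_elt f -> positive_elt g ->
  complex.Re (f x) * complex.Re (g x) <= cnorm (f * g).
Proof.
move=> /(positive_Re x)[f0 fE] /(positive_Re x)[g0 gE].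
apply: le_trans (Re_cfun_le (f * g) x).
have -> : (f * g) x = (complex.Re (f x))%:C * (complex.Re (g x))%:C :> R[i].
  by rewrite -fE -gE.
by rewrite -rmorphM/= ler_norm.
Qed.

(* At every point exactly one of the three values is close to 1.  By
   connectedness it is always g0 or never g0, and the rotation carries either
   alternative over to g1 and g2. *)
Lemma no_circle_tower (theta : R) (g0 g1 g2 : circle R -> R) :
  continuous g0 ->
  (forall x, [/\ 0 <= g0 x, 0 <= g1 x & 0 <= g2 x]) ->
  (forall x, g0 x * g1 x < 1 / 100) -> (forall x, g0 x * g2 x < 1 / 100) ->
  (forall x, `|g0 x + g1 x + g2 x - 1| < 1 / 100) ->
  (forall x, `|g0 (x - circle_pi theta) - g1 x| < 1 / 100) ->
  (forall x, g2 x < g1 (x - circle_pi theta) + 1 / 100) -> False.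
Proof.
move=> cg0 gge0 h01 h02 hsum hrot hrot2.
(* If g0 were 1/2, both other values would be below 1/50, too small for a sum near 1. *)
have half x : g0 x <> 1 / 2.
  move=> E; have := h01 x; have := h02 x; have := hsum x.
  by rewrite E ltr_norml => /andP[]; lra.
(* Connectedness enters as the intermediate value theorem for the lift of g0 to the real line. *)
have side s t : g0 (circle_pi s) < 1 / 2 -> 1 / 2 < g0 (circle_pi t) -> False.
  move=> hs ht.
  have cont : continuous (g0 \o @circle_pi R).
    by move=> u; apply: continuous_comp; [exact: circle_pi_continuous|exact: cg0].
  have [st|ts] := lerP s t.
    have [||u _] := @IVT R (g0 \o @circle_pi R) s t (1 / 2) st.
    - exact: continuous_subspaceT.
    - by rewrite /= ge_min le_max (ltW hs) (ltW ht) orbT.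
    exact: half.
  have [||u _] := @IVT R (g0 \o @circle_pi R) t s (1 / 2) (ltW ts).
  - exact: continuous_subspaceT.
  - by rewrite /= ge_min le_max (ltW hs) (ltW ht) !orbT.
  exact: half.
pose x0 := circle_pi (0 : R); pose x1 := x0 - circle_pi theta.
pose x2 := x1 - circle_pi theta.
have := hrot x0; have := hrot x1; rewrite -/x1 -/x2 !ltr_norml.
move=> /andP[r1 r1'] /andP[r0 r0']; have r2 := hrot2 x0; rewrite -/x1 in r2.
have := hsum x0; rewrite ltr_norml => /andP[s0 s0'].
have [g00 g10 g20] := gge0 x0.
have p01 := h01 x0; have p02 := h02 x0.
have [lt|gt] : g0 x0 < 1 / 2 \/ 1 / 2 < g0 x0.
- by have /eqP := half x0; rewrite neq_lt => /orP.
- have all_lt x : g0 x < 1 / 2.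
    have /eqP := half x; rewrite neq_lt => /orP[//|].
    by rewrite -(circle_piK x) => h; case: (side 0 (repr x)).
  (* Multiplying the sum by g0 gives g0 (0.99 - g0) < 0.02, so g0 < 1/2 improves to g0 < 0.05. Along
     the orbit, g1 and g2 are then small at x0 as well, and the sum there cannot be near 1. *)
  have small x : g0 x < 5 / 100.
    have := hsum x; rewrite ltr_norml => /andP[a b].
    have := h01 x; have := h02 x; have := all_lt x; have [] := gge0 x.
    by nra.
  have := small x0; have := small x1; have := small x2; lra.
- have gt1 : 1 / 2 < g0 x1.
    have /eqP := half x1; rewrite neq_lt => /orP[|//].
    by rewrite -(circle_piK x1) => h; case: (side (repr x1) 0).
  (* g0 > 1/2 at x1 makes g1 > 0.49 at x0, so the product of g0 and g1 at x0 is too large. *)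
  nra.
Qed.

(** The height p = 2 is taken because for p = 1 the constant function 1 is a tower. The surviving
    tower has height 2 or 3, and [no_circle_tower] handles both. *)
Lemma rotation_no_single_towers0 (theta : R) :
  ~ has_single_towers (rotation theta) 0.
Proof.
move=> /(_ set0 2%N (1 / 100) (finite_set0 _) isT).
have e0 : 0 < 1 / 100 :> R by lra.
move=> /(_ e0)[f [pos vanish [orth sum1 rot _ _]]]; have [r hr] := vanish 0.
pose g r j x : R := complex.Re (f 0 r j x).
have gsum x : `|g 0 0%N x + g 0 1%N x + g 1 0%N x + g 1 1%N x + g 1 2%N x - 1|
    < 1 / 100.
  apply: le_lt_trans sum1; apply: le_trans (Re_cfun_le _ x).
  rewrite (_ : _ - 1 = complex.Re ((\sum_(l < 1) \sum_(r < 2) \sum_(j < 2 + r)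
    (f l r j x : R[i])) - 1)); last first.
    rewrite big_ord1 big_ord_recl big_ord1.
    rewrite (_ : lift ord0 ord0 = 1 :> 'I_2); last exact/val_inj.
    rewrite !big_ord_recl !big_ord0 !addr0.
    by rewrite /g raddfB !raddfD/= !addrA.
  under eq_bigr => l _.
    under eq_bigr => r' _ do rewrite -cfun_sumE.
    rewrite -cfun_sumE; over.
  by rewrite -cfun_sumE.
have gpos (r' : 'I_2) j x : (j < 2 + r')%N -> 0 <= g r' j x.
  by move=> /(pos 0 r' j)/(positive_Re x)[].
have gorth (r' : 'I_2) i j x : (i < 2 + r')%N -> (j < 2 + r')%N -> i <> j ->
    g r' i x * g r' j x < 1 / 100.
  move=> ir jr ij;
  apply: le_lt_trans (Re_cfunM_le x (pos _ _ _ ir) (pos _ _ _ jr)) _.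
  by apply: orth => // -[].
have grot (r' : 'I_2) j x : (j.+1 < 2 + r')%N ->
    `|g r' j (x - circle_pi theta) - g r' j.+1 x| < 1 / 100.
  move=> /(rot 0); apply: le_lt_trans; apply: le_trans (Re_cfun_le _ x).
  by rewrite /g -raddfB.
have [r0|r1] : r = 0 \/ r = 1.
  by case: (r) => [[|[|//]]] ?; [left|right]; exact/val_inj.
- have g0 j x : (j < 2)%N -> g 0 j x = 0.
    by move=> j2; rewrite /g -r0 hr// r0.
  apply: (@no_circle_tower theta (g 1 0%N) (g 1 1%N) (g 1 2%N)).
  + exact: Re_cfun_continuous.
  + by move=> x; split; exact: gpos.
  + by move=> x; exact: gorth.
  + by move=> x; exact: gorth.
  + by move=> x; have := gsum x; rewrite !g0// !add0r.
  + by move=> x; exact: grot.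
  + move=> x; have /ltr_normlP[] := grot 1 1%N x isT; lra.
- have g1 j x : (j < 3)%N -> g 1 j x = 0.
    by move=> j2; rewrite /g -r1 hr// r1.
  (* The tower of height 2 is padded with 0; the last hypothesis of [no_circle_tower] is one-sided
     so that this is allowed. *)
  apply: (@no_circle_tower theta (g 0 0%N) (g 0 1%N) (fun=> 0)).
  + exact: Re_cfun_continuous.
  + by move=> x; split => //; exact: gpos.
  + by move=> x; exact: gorth.
  + by move=> x; rewrite mulr0.
  + by move=> x; have := gsum x; rewrite !g1// !addr0.
  + by move=> x; exact: grot.
  + by move=> x; have := gpos 0 1%N (x - circle_pi theta) isT; lra.
Qed.
End lower.

Theorem theorem7p2 (R : realType) (theta : R) (htheta : irrational theta) :
  dimRok_s (rotation theta) = Some 1%N.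
Proof.
rewrite /dimRok_s; case: pselect => [ex|[]]; last first.
  by exists 1%N; apply/asboolP; exact: rotation_has_single_towers.
congr Some; case: ex_minnP => m /asboolP hm min_m.
have : (m <= 1)%N.
  by apply: min_m; apply/asboolP; exact: rotation_has_single_towers.
by case: m hm {min_m} => [/rotation_no_single_towers0|[|]].
Qed.
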